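(* Let $(X,p)$ be a $0$-complete partial $b$-metric space with coefficient $s\geq1$ and let $T:X\to X$ be a self mapping such that for all $x,y\in X$ $$p(Tx,Ty)\leq\lambda_1p(x,y)+\lambda_2\frac{p(x,Tx)p(y,Ty)}{1+p(x,y)}+\lambda_3\frac{p(x,Ty)p(y,Tx)}{1+p(x,y)}+\lambda_4\frac{p(x,Tx)p(x,Ty)}{1+p(x,y)}+\lambda_5\frac{p(y,Ty)p(y,Tx)}{1+p(x,y)},$$ where $\lambda_1,\lambda_2,\lambda_3,\lambda_4,\lambda_5$ are nonnegative real numbers satisfying $$\lambda_1+\lambda_2+2s\lambda_3+s\lambda_4+s\lambda_5<1.$$ If in addition $2s\lambda_1+2\lambda_3+(s+s^2)(\lambda_4+\lambda_5)<2$, then for every $x_0\in X$ Picard's iteration $x_{n+1}=Tx_n$ is $T$-stable.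
   Context: A partial $b$-metric space with coefficient $s\geq1$ is a pair $(X,p)$ where $X$ is a set and $p:X\times X\to[0,\infty)$ satisfies: (pm1) for all $x,y\in X$, $x=y$ if and only if $p(x,x)=p(x,y)=p(y,y)$; (pm2) $0\leq p(x,x)\leq p(x,y)$ for all $x,y\in X$; (pm3) $p(x,y)=p(y,x)$ for all $x,y\in X$; (pm4) $p(x,y)+p(z,z)\leq s[p(x,z)+p(z,y)]$ for all $x,y,z\in X$. A sequence $(x_n)$ in $X$ is $0$-Cauchy if $\lim_{n,m\to\infty}p(x_n,x_m)=0$. $(X,p)$ is $0$-complete if for every $0$-Cauchy sequence $(x_n)$ in $X$ there exists $x\in X$ with $\lim_{n,m\to\infty}p(x_n,x_m)=\lim_{n\to\infty}p(x_n,x)=p(x,x)=0$. A sequence $(x_n)$ converges to $x\in X$, written $x_n\overset{p}{\longrightarrow}x$, if $\lim_{n\to\infty}p(x,x_n)=p(x,x)$. Let $F(T)$ denote the set of fixed points of $T$. For $x_0\in X$ and $T$ with $F(T)\neq\emptyset$, Picard's iteration $x_{n+1}=Tx_n$ is said to be $T$-stable if $x_n\overset{p}{\longrightarrow}q$ for some $q\in F(T)$ and, whenever $(y_n)$ is a sequence in $X$ with $\lim_{n\to\infty}p(y_{n+1},Ty_n)=0$, one has $y_n\overset{p}{\longrightarrow}q$. *)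

(* Defs.v *)
From HB Require Import structures.
From mathcomp Require Import all_boot all_order all_algebra.
From mathcomp Require Import all_classical all_reals all_analysis.

Set Implicit Arguments.
Unset Strict Implicit.
Unset Printing Implicit Defensive.

Import Order.TTheory GRing.Theory Num.Theory.
Import numFieldNormedType.Exports.

Local Open Scope classical_set_scope.
Local Open Scope ring_scope.

(* Values of p lie in [0, +oo[ by pm2. *)
Record partial_b_metric (R : realType) (X : Type) (s : R) (p : X -> X -> R) :
    Prop := PartialBMetric {
  coeff_ge1 : 1 <= s ;
  pm1 : forall x y, x = y <-> p x x = p x y /\ p x y = p y y ;
  pm2 : forall x y, 0 <= p x x /\ p x x <= p x y ;
  pm3 : forall x y, p x y = p y x ;
  pm4 : forall x y z, p x y + p z z <= s * (p x z + p z y)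
}.

(* Limits as n, m -> oo are taken jointly, along the product filter
   (\oo, \oo). *)
Definition zero_cauchy (R : realType) (X : Type) (p : X -> X -> R)
    (x : nat -> X) : Prop :=
  p (x nm.1) (x nm.2) @[nm --> (\oo, \oo)] --> (0 : R).

Definition zero_complete (R : realType) (X : Type) (p : X -> X -> R) : Prop :=
  forall x : nat -> X, zero_cauchy p x ->
  exists a : X,
    [/\ p (x nm.1) (x nm.2) @[nm --> (\oo, \oo)] --> p a a,
        p (x n) a @[n --> \oo] --> p a a
      & p a a = 0].

Definition p_converges (R : realType) (X : Type) (p : X -> X -> R)
    (x : nat -> X) (a : X) : Prop :=
  p a (x n) @[n --> \oo] --> p a a.

Definition fixed_points (X : Type) (T : X -> X) : set X := [set q | T q = q].

Definition picard (X : Type) (T : X -> X) (x0 : X) (n : nat) : X := iter n T x0.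

Definition picard_T_stable (R : realType) (X : Type) (p : X -> X -> R)
    (T : X -> X) (x0 : X) : Prop :=
  exists q : X,
    [/\ fixed_points T q,
        p_converges p (picard T x0) q
      & forall y : nat -> X,
          p (y n.+1) (T (y n)) @[n --> \oo] --> (0 : R) ->
          p_converges p y q].

(* Main.v *)
(** Along a Picard orbit [x], put [d_n = p (x n) (x n.+1)] and
    [r = l1 + l2 + 2 s l3 + s l4 + s l5 < 1]. Averaging the contractive condition
    for [(x, y)] and [(y, x)] makes it symmetric in [l4] and [l5] and yields
    [d_(n+1) <= r d_n]. Although [s r] may exceed 1, the orbit is 0-Cauchy: for
    [N] with [s r ^ N < 1], jumps of length [N] can be chained. Its limit [q] is
    fixed. For stability, the averaged condition at [(y, q)] gives
    [p (T y) q <= k p y q], where the second hypothesis says exactly that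
    [s k < 1]; hence
    [p (y n.+1) q <= s p (y n.+1) (T (y n)) + s k p (y n) q] forces
    [p (y n) q --> 0]. *)

Require Import Defs.
From HB Require Import structures.
From mathcomp Require Import all_boot all_order all_algebra.
From mathcomp Require Import all_classical all_reals all_analysis.
From mathcomp Require Import ring lra.

Set Implicit Arguments.
Unset Strict Implicit.
Unset Printing Implicit Defensive.

Import Order.TTheory GRing.Theory Num.Theory.
Import numFieldNormedType.Exports.

Local Open Scope classical_set_scope.
Local Open Scope ring_scope.

(** * Real inequalities and a perturbed contraction *)

(** Linearizes the quadratic terms of the contractive condition: a factor [a] of the numerator is
    absorbed by [1 + a]. *)
Lemma divr_onePl_le (R : realFieldType) (a y z : R) :
  0 <= a -> 0 <= y -> z <= a * y -> z / (1 + a) <= y.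
Proof.
move=> a0 y0 zay; rewrite ler_pdivrMr; last by lra.
by rewrite mulrDr mulr1 (le_trans zay)// mulrC lerDr.
Qed.

Lemma divr_onePl_le_id (R : realFieldType) (a z : R) :
  0 <= a -> 0 <= z -> z / (1 + a) <= z.
Proof.
move=> a0 z0; rewrite ler_pdivrMr; last by lra.
by rewrite mulrDr mulr1 lerDl mulr_ge0.
Qed.

(** Once [e n <= (1 - r) * (eps / 2)], the level [eps / 2] is fixed by the affine bound on [a n.+1],
    so the excess of [a] over that level is damped by [r] at every step. *)
Lemma cvg0_perturbed_contraction (R : realType) (a e : nat -> R) (r : R) :
  0 <= r < 1 -> (forall n, 0 <= a n) -> (forall n, a n.+1 <= r * a n + e n) ->
  e n @[n --> \oo] --> (0 : R) -> a n @[n --> \oo] --> (0 : R).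
Proof.
move=> /andP[r0 r1] a0 aS e0; apply/cvgrPdist_le => eps eps0.
have eta0 : 0 < (1 - r) * (eps / 2) by apply: mulr_gt0; lra.
move/cvgrPdist_le: e0 => /(_ _ eta0)[N _ eN].
have aN k : a (N + k)%N <= eps / 2 + r ^+ k * a N.
  elim: k => [|k IH]; first by rewrite addn0 expr0; lra.
  rewrite addnS (le_trans (aS _))//.
  have := eN (N + k)%N (leq_addr _ _); rewrite sub0r normrN => /(le_trans (ler_norm _)) he.
  have := ler_wpM2l r0 IH; rewrite exprS; lra.
have geo : r ^+ k * a N @[k --> \oo] --> (0 : R).
  rewrite -[0](mul0r (a N)); apply: cvgM; last exact: cvg_cst.
  by apply: cvg_expr; rewrite ger0_norm.
have eps2 : 0 < eps / 2 by lra.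
move/cvgrPdist_le: geo => /(_ _ eps2)[M _ rM].
exists (N + M)%N => // n /= NMn.
have Nn : (N <= n)%N by rewrite (leq_trans _ NMn)// leq_addr.
rewrite sub0r normrN ger0_norm// -(subnKC Nn) (le_trans (aN _))//.
have /rM : (M <= n - N)%N by rewrite leq_subRL.
rewrite sub0r normrN => /(le_trans (ler_norm _)); lra.
Qed.

(** * Partial b-metrics and sequences with geometrically decaying steps *)

Lemma partial_b_metric_ge0 (R : realType) (X : Type) (s : R) (p : X -> X -> R)
    (hp : partial_b_metric s p) (x y : X) : 0 <= p x y.
Proof. by have [h1 h2] := pm2 hp x y; exact: le_trans h2. Qed.

Lemma partial_b_metric_triangle (R : realType) (X : Type) (s : R)
    (p : X -> X -> R) (hp : partial_b_metric s p) (z x y : X) :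
  p x y <= s * (p x z + p z y).
Proof.
by apply: le_trans (pm4 hp x y z); rewrite lerDl (partial_b_metric_ge0 hp).
Qed.

Lemma partial_b_metric_eq0 (R : realType) (X : Type) (s : R)
    (p : X -> X -> R) (hp : partial_b_metric s p) (x y : X) :
  p x y = 0 -> x = y.
Proof.
move=> xy0; apply/(pm1 hp); rewrite xy0.
have [x0 xxy] := pm2 hp x y; have [y0 yyx] := pm2 hp y x.
by move: yyx; rewrite (pm3 hp y x); split; lra.
Qed.

(** Appending one step to a jump costs one more factor [s], so [C] grows with [N]; this is harmless
    while the jump length stays bounded. *)
Lemma geometric_steps_bounded_jumps (R : realType) (X : Type) (s : R)
    (p : X -> X -> R) (hp : partial_b_metric s p) (x : nat -> X) (r c : R) :
  0 <= r < 1 -> (forall n, p (x n) (x n.+1) <= c * r ^+ n) ->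
  forall N, exists C, forall n k, (k <= N)%N ->
    p (x n) (x (n + k)%N) <= C * r ^+ n.
Proof.
move=> /andP[r0 r1] xS; have s1 := coeff_ge1 hp.
have c0 : 0 <= c.
  have := xS 0%N; rewrite expr0 mulr1.
  exact/le_trans/(partial_b_metric_ge0 hp).
elim=> [|N [C IH]].
  exists c => n k; rewrite leqn0 => /eqP ->; rewrite addn0.
  exact: le_trans (pm2 hp _ _).2 (xS n).
have C0 : 0 <= C.
  have := IH 0%N 0%N (leq0n _); rewrite expr0 mulr1.
  exact/le_trans/(partial_b_metric_ge0 hp).
exists (s * (C + c)) => n k; rewrite leq_eqVlt => /orP[/eqP ->|kN].
  apply: le_trans (partial_b_metric_triangle hp (x (n + N)%N) _ _) _.
  rewrite -mulrA ler_wpM2l ?(le_trans ler01)// mulrDl lerD ?IH//.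
  rewrite addnS (le_trans (xS _))// ler_wpM2l// exprD ler_piMr ?exprn_ge0//.
  by rewrite exprn_ile1 ?r0 ?ltW.
rewrite (le_trans (IH n k kN))// ler_wpM2r ?exprn_ge0//.
nra.
Qed.

(** A long jump splits into one of length [N.+1] and a remainder starting at [n + N.+1]. The late
    start gains [r ^+ N.+1] on the remainder, which outweighs the factor [s] of the triangle
    inequality. *)
Lemma geometric_steps_bound (R : realType) (X : Type) (s : R)
    (p : X -> X -> R) (hp : partial_b_metric s p) (x : nat -> X) (r c : R) :
  0 <= r < 1 -> (forall n, p (x n) (x n.+1) <= c * r ^+ n) ->
  exists K, forall n k, p (x n) (x (n + k)%N) <= K * r ^+ n.
Proof.
move=> r01 xS; have /andP[r0 r1] := r01; have s1 := coeff_ge1 hp.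
have [N srN] : exists N, s * r ^+ N.+1 < 1.
  have geo : s * r ^+ k @[k --> \oo] --> (0 : R).
    by apply: cvg_geometric; rewrite ger0_norm.
  move/cvgrPdist_lt: geo => /(_ _ ltr01)[N _ hN].
  exists N; have := hN N.+1 (leqnSn _).
  by rewrite /= sub0r normrN => /(le_lt_trans (ler_norm _)).
have [C hC] := geometric_steps_bounded_jumps hp r01 xS N.+1.
have C0 : 0 <= C.
  have := hC 0%N 0%N (leq0n _); rewrite expr0 mulr1.
  exact/le_trans/(partial_b_metric_ge0 hp).
set rho := s * r ^+ N.+1 in srN.
have rho0 : 0 <= rho by rewrite mulr_ge0 ?exprn_ge0//; lra.
(* [K] solves [s * C + rho * K = K], so the induction on the jump length reproduces the same
   constant. *)
pose K := s * C / (1 - rho).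
have KE : s * C + rho * K = K by rewrite /K; field; lra.
have CK : C <= K.
  have K0 : 0 <= K by rewrite divr_ge0 ?mulr_ge0//; lra.
  nra.
exists K => n k; elim/ltn_ind: k n => k IH n.
have [kN|Nk] := leqP k N.+1.
  by rewrite (le_trans (hC n k kN))// ler_wpM2r ?exprn_ge0.
apply: le_trans (partial_b_metric_triangle hp (x (n + N.+1)%N) _ _) _.
have kE : (n + k = n + N.+1 + (k - N.+1))%N by rewrite -addnA subnKC// ltnW.
have h1 := hC n N.+1 (leqnn _).
have kk : (k - N.+1 < k)%N by rewrite ltn_subrL (leq_trans _ Nk).
have h2 := IH _ kk (n + N.+1)%N; rewrite -kE in h2.
apply: (@le_trans _ _ (s * (C * r ^+ n + K * r ^+ (n + N.+1)))).
  by rewrite ler_wpM2l ?lerD//; lra.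
rewrite -[X in _ <= X * _]KE exprD /rho.
by rewrite le_eqVlt; apply/orP; left; apply/eqP; ring.
Qed.

Lemma geometric_steps_zero_cauchy (R : realType) (X : Type) (s : R)
    (p : X -> X -> R) (hp : partial_b_metric s p) (x : nat -> X) (r c : R) :
  0 <= r < 1 -> (forall n, p (x n) (x n.+1) <= c * r ^+ n) ->
  zero_cauchy p x.
Proof.
move=> r01 xS; have /andP[r0 r1] := r01.
have [K hK] := geometric_steps_bound hp r01 xS.
have Kr0 n : 0 <= K * r ^+ n.
  by have := hK n 0%N; exact/le_trans/(partial_b_metric_ge0 hp).
(* The sum dominates the term at the smaller index, and each summand depends on one index only, so
   the joint limit reduces to the two projections. *)
have bound n m : p (x n) (x m) <= K * r ^+ n + K * r ^+ m.
  have [nm|/ltnW mn] := leqP n m.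
    by have := hK n (m - n)%N; rewrite subnKC//; have := Kr0 m; lra.
  rewrite (pm3 hp); have := hK m (n - m)%N; rewrite subnKC//.
  by have := Kr0 n; lra.
have geo : K * r ^+ k @[k --> \oo] --> (0 : R).
  by apply: cvg_geometric; rewrite ger0_norm.
apply: (@squeeze_cvgr _ _ _ _ (fun=> 0)
  (fun nm : nat * nat => K * r ^+ nm.1 + K * r ^+ nm.2)).
- by apply: nearW => nm; rewrite (partial_b_metric_ge0 hp) bound.
- exact: cvg_cst.
- rewrite -[0]addr0; apply: cvgD.
    by apply: (cvg_comp _ _ _ geo); exact: cvg_fst.
  by apply: (cvg_comp _ _ _ geo); exact: cvg_snd.
Qed.

(** * Consequences of the contractive condition *)

(* With [a = p x (T x)], [b = p (T x) (T (T x))], [c = p x (T (T x))] and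
   [e = p (T x) (T x)], [h] and [h'] are the contractive condition at
   [(x, T x)] and [(T x, x)]. *)
Lemma averaged_step_le (R : realFieldType) (s l1 l2 l3 l4 l5 a b c e : R) :
  1 <= s -> 0 <= l1 -> 0 <= l2 -> 0 <= l3 -> 0 <= l4 -> 0 <= l5 ->
  l1 + l2 + 2 * s * l3 + s * l4 + s * l5 < 1 ->
  0 <= c -> 0 <= e -> e <= a -> e <= b -> c + e <= s * (a + b) ->
  b <= l1 * a + l2 * (a * b / (1 + a)) + l3 * (c * e / (1 + a))
       + l4 * (a * c / (1 + a)) + l5 * (b * e / (1 + a)) ->
  b <= l1 * a + l2 * (b * a / (1 + a)) + l3 * (e * c / (1 + a))
       + l4 * (b * e / (1 + a)) + l5 * (a * c / (1 + a)) ->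
  b <= (l1 + l2 + 2 * s * l3 + s * l4 + s * l5) * a.
Proof.
move=> s1 hl1 hl2 hl3 hl4 hl5 hsum c0 e0 ea eb ceab h h'.
set r := (_ + s * l5) in hsum *.
have a0 : 0 <= a by lra.
(* [M] is the maximum of [a] and [b]. Bounding everything by [M] first gives [b <= r * M]; the case
   [M = b] is excluded at the end. *)
have [M [aM bM Mab]] : exists M, [/\ a <= M, b <= M & M = a /\ b <= a \/ M = b /\ a < b].
  by have [ba|ab] := leP b a; [exists a|exists b]; split=> //; [left|exact: ltW|right].
have M0 : 0 <= M by lra.
have sM0 : 0 <= 2 * s * M by rewrite !mulr_ge0//; lra.
have T2 : a * b / (1 + a) <= M by apply: divr_onePl_le => //; rewrite ler_wpM2l.
have c2 : c <= 2 * s * M by nra.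
have T3 : c * e / (1 + a) <= 2 * s * M.
  apply: divr_onePl_le => //; rewrite mulrC; exact: ler_pM.
(* Adding [h] and [h'] gives [l4] and [l5] this common factor. The [- e] kept from pm4 is essential:
   it leaves [(b - a) * e] to control, which is nonpositive if [b <= a] and at most [(b - a) * a]
   otherwise. *)
have T45 : (a * c + b * e) / (1 + a) <= 2 * s * M.
  apply: divr_onePl_le => //.
  have ac : a * c <= a * (s * (a + b) - e) by rewrite ler_wpM2l//; lra.
  have sa0 : 0 <= s * a by rewrite mulr_ge0//; lra.
  case: Mab => -[-> ab].
    have : 0 <= (a - b) * e by rewrite mulr_ge0//; lra.
    have : 0 <= (a - b) * (s * a) by rewrite mulr_ge0//; lra.
    lra.
  have : 0 <= (b - a) * (a - e) by rewrite mulr_ge0//; lra.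
  have : 0 <= (s - 1) * a * (b - a) by rewrite !mulr_ge0//; lra.
  lra.
have brM : b <= r * M.
  rewrite (mulrC b a) (mulrC e c) in h'; rewrite mulrDl in T45.
  have := ler_wpM2l hl1 aM; have := ler_wpM2l hl2 T2.
  have := ler_wpM2l hl3 T3; have := ler_wpM2l (addr_ge0 hl4 hl5) T45.
  rewrite /r; lra.
(* If [M = b], then [b <= r * b] with [r < 1] contradicts [0 <= a < b]. *)
by case: Mab => -[ME ab]; rewrite ME in brM => //; nra.
Qed.

Lemma picard_step_le (R : realType) (X : Type) (s : R) (p : X -> X -> R)
    (T : X -> X) (l1 l2 l3 l4 l5 : R)
    (hp : partial_b_metric s p)
    (hl1 : 0 <= l1) (hl2 : 0 <= l2) (hl3 : 0 <= l3) (hl4 : 0 <= l4)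
    (hl5 : 0 <= l5)
    (hsum : l1 + l2 + 2 * s * l3 + s * l4 + s * l5 < 1)
    (hT : forall x y : X,
      p (T x) (T y) <=
        l1 * p x y
        + l2 * (p x (T x) * p y (T y) / (1 + p x y))
        + l3 * (p x (T y) * p y (T x) / (1 + p x y))
        + l4 * (p x (T x) * p x (T y) / (1 + p x y))
        + l5 * (p y (T y) * p y (T x) / (1 + p x y))) (x : X) :
  p (T x) (T (T x)) <=
    (l1 + l2 + 2 * s * l3 + s * l4 + s * l5) * p x (T x).
Proof.
have [e0 eb] := pm2 hp (T x) (T (T x)).
have [_ ea] := pm2 hp (T x) x; rewrite (pm3 hp _ x) in ea.
have h := hT x (T x); have := hT (T x) x.
rewrite (pm3 hp (T (T x)) (T x)) (pm3 hp (T x) x) => h'.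
exact: (averaged_step_le (coeff_ge1 hp) hl1 hl2 hl3 hl4 hl5 hsum
  (partial_b_metric_ge0 hp x (T (T x))) e0 ea eb (pm4 hp _ _ _) h h').
Qed.

(** The constant [p q (T q)] is bounded through [x n.+1] by the contractive condition at [(x n, q)],
    with the denominators, at least 1, dropped. Every term of the bound contains a factor tending to
    0. *)
Lemma picard_limit_fixed (R : realType) (X : Type) (s : R) (p : X -> X -> R)
    (T : X -> X) (l1 l2 l3 l4 l5 : R)
    (hp : partial_b_metric s p)
    (hl2 : 0 <= l2) (hl3 : 0 <= l3) (hl4 : 0 <= l4) (hl5 : 0 <= l5)
    (hT : forall x y : X,
      p (T x) (T y) <=
        l1 * p x y
        + l2 * (p x (T x) * p y (T y) / (1 + p x y))
        + l3 * (p x (T y) * p y (T x) / (1 + p x y))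
        + l4 * (p x (T x) * p x (T y) / (1 + p x y))
        + l5 * (p y (T y) * p y (T x) / (1 + p x y)))
    (x : nat -> X) (q : X) :
  (forall n, x n.+1 = T (x n)) -> p (x n) q @[n --> \oo] --> (0 : R) ->
  T q = q.
Proof.
move=> xS u0; have s1 := coeff_ge1 hp; have p0 := partial_b_metric_ge0 hp.
apply/esym/(partial_b_metric_eq0 hp).
set A := p q (T q).
(* Going through [q], [d n] majorizes [p (x n) (x n.+1)] and [w n] majorizes [p (x n) (T q)]; [d]
   tends to 0 while [w] only stays bounded. *)
pose u n := p (x n) q; pose d n := s * (u n + u n.+1).
pose w n := s * (u n + A).
pose B n := s * (u n.+1 + (l1 * u n + l2 * (d n * A) + l3 * (w n * u n.+1)
                 + l4 * (d n * w n) + l5 * (A * u n.+1))).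
have AB n : A <= B n.
  apply: le_trans (partial_b_metric_triangle hp (x n.+1) _ _) _.
  rewrite ler_wpM2l//; first lra.
  rewrite (pm3 hp q) lerD2l xS (le_trans (hT _ _))// -xS.
  have dn : p (x n) (x n.+1) <= d n.
    by apply: le_trans (partial_b_metric_triangle hp q _ _) _; rewrite (pm3 hp q).
  have wn : p (x n) (T q) <= w n := partial_b_metric_triangle hp q _ _.
  rewrite (pm3 hp q (x n.+1)) -/(u n) -/(u n.+1) -/A.
  have frac z z' : 0 <= z -> z <= z' -> z / (1 + u n) <= z'.
    by move=> z0; apply: le_trans; apply: divr_onePl_le_id => //; exact: p0.
  have [un un1 A0] : [/\ 0 <= u n, 0 <= u n.+1 & 0 <= A] by split; exact: p0.
  by rewrite !lerD// ler_wpM2l// frac// ?mulr_ge0// ler_pM.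
have u1 : u n.+1 @[n --> \oo] --> (0 : R).
  by have := u0; rewrite -cvg_shiftS.
have d0 : d n @[n --> \oo] --> (s * (0 + 0)).
  by apply: cvgM; [exact: cvg_cst|exact: cvgD].
have w0 : w n @[n --> \oo] --> (s * (0 + A)).
  by apply: cvgM; [exact: cvg_cst|apply: cvgD => //; exact: cvg_cst].
have B0 : B n @[n --> \oo] -->
    s * (0 + (l1 * 0 + l2 * (s * (0 + 0) * A) + l3 * (s * (0 + A) * 0)
                 + l4 * (s * (0 + 0) * (s * (0 + A))) + l5 * (A * 0))).
  by rewrite /B; repeat (first [exact: u0|exact: u1|exact: d0|exact: w0
    |exact: cvg_cst|apply: cvgD|apply: cvgM]).
apply/eqP; rewrite eq_le p0 andbT.
have -> : 0 = s * (0 + (l1 * 0 + l2 * (s * (0 + 0) * A) + l3 * (s * (0 + A) * 0)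
                 + l4 * (s * (0 + 0) * (s * (0 + A))) + l5 * (A * 0))) by ring.
rewrite -(cvg_lim _ B0)//; apply: limr_ge; first by apply/cvg_ex; eexists; exact: B0.
exact: nearW.
Qed.

Lemma fixed_point_contraction (R : realType) (X : Type) (s : R)
    (p : X -> X -> R) (T : X -> X) (l1 l2 l3 l4 l5 : R)
    (hp : partial_b_metric s p)
    (hl1 : 0 <= l1) (hl3 : 0 <= l3) (hl4 : 0 <= l4) (hl5 : 0 <= l5)
    (hT : forall x y : X,
      p (T x) (T y) <=
        l1 * p x y
        + l2 * (p x (T x) * p y (T y) / (1 + p x y))
        + l3 * (p x (T y) * p y (T x) / (1 + p x y))
        + l4 * (p x (T x) * p x (T y) / (1 + p x y))
        + l5 * (p y (T y) * p y (T x) / (1 + p x y)))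
    (hstab : 2 * s * l1 + 2 * l3 + (s + s ^+ 2) * (l4 + l5) < 2) (q : X) :
  T q = q -> p q q = 0 ->
  exists k, 0 <= s * k < 1 /\ forall y, p (T y) q <= k * p y q.
Proof.
move=> Tq q0; have s1 := coeff_ge1 hp; have p0 := partial_b_metric_ge0 hp.
(* With [p q (T q) = 0], averaging the conditions at [(y, q)] and [(q, y)] leaves
   [w <= l1 * u + l3 * w + L * s * (u + w)], that is [D * w <= (l1 + s * L) * u]. This dictates the
   witness for [k]. *)
pose L := (l4 + l5) / 2; pose D := 1 - l3 - s * L.
have L0 : 0 <= L by rewrite divr_ge0// addr_ge0.
have num0 : 0 <= l1 + s * L by rewrite addr_ge0// mulr_ge0//; lra.
have hs : s * (l1 + s * L) < D by rewrite /D /L; lra.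
have D0 : 0 < D by apply: le_lt_trans hs; rewrite mulr_ge0//; lra.
exists ((l1 + s * L) / D); split.
  rewrite mulrA ltr_pdivrMr// mul1r hs andbT.
  by rewrite divr_ge0 ?(ltW D0)// mulr_ge0//; lra.
move=> y; have h := hT y q; have h' := hT q y.
rewrite !Tq (pm3 hp q (T y)) !(pm3 hp q y) q0 in h h'.
set u := p y q in h h' *; set w := p (T y) q in h h' *; set v := p y (T y) in h h'.
have u0 : 0 <= u by exact: p0.
have w0 : 0 <= w by exact: p0.
have v0 : 0 <= v by exact: p0.
have vuw : v <= s * (u + w).
  by apply: le_trans (partial_b_metric_triangle hp q _ _) _; rewrite (pm3 hp q).
have T3 : u * w / (1 + u) <= w by exact: divr_onePl_le.
have T4 : v * u / (1 + u) <= s * (u + w).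
  apply: divr_onePl_le => //; first exact: le_trans vuw.
  by rewrite mulrC ler_wpM2l.
rewrite mulrAC ler_pdivlMr//.
have := ler_wpM2l hl3 T3; have := ler_wpM2l L0 T4.
rewrite (mulrC w u) in h'; rewrite /D /L; lra.
Qed.

(** * Stability of Picard's iteration *)

Theorem theorem3p10 (R : realType) (X : Type) (s : R) (p : X -> X -> R)
    (T : X -> X) (l1 l2 l3 l4 l5 : R)
    (hp : partial_b_metric s p)
    (hcomplete : zero_complete p)
    (hl1 : 0 <= l1) (hl2 : 0 <= l2) (hl3 : 0 <= l3) (hl4 : 0 <= l4)
    (hl5 : 0 <= l5)
    (hsum : l1 + l2 + 2 * s * l3 + s * l4 + s * l5 < 1)
    (hT : forall x y : X,
      p (T x) (T y) <=
        l1 * p x y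
        + l2 * (p x (T x) * p y (T y) / (1 + p x y))
        + l3 * (p x (T y) * p y (T x) / (1 + p x y))
        + l4 * (p x (T x) * p x (T y) / (1 + p x y))
        + l5 * (p y (T y) * p y (T x) / (1 + p x y)))
    (hstab : 2 * s * l1 + 2 * l3 + (s + s ^+ 2) * (l4 + l5) < 2) :
  forall x0 : X, picard_T_stable p T x0.
Proof.
move=> x0; have s1 := coeff_ge1 hp; have p0 := partial_b_metric_ge0 hp.
set r := l1 + l2 + 2 * s * l3 + s * l4 + s * l5 in hsum.
have r01 : 0 <= r < 1 by rewrite hsum andbT !addr_ge0// !mulr_ge0//; lra.
have steps n : p (picard T x0 n) (picard T x0 n.+1) <= p x0 (T x0) * r ^+ n.
  elim: n => [|n IH]; first by rewrite expr0 mulr1.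
  apply: le_trans (picard_step_le hp hl1 hl2 hl3 hl4 hl5 hsum hT _) _.
  by rewrite exprS mulrCA ler_wpM2l//; have /andP[] := r01.
have [q [_ xq q0]] := hcomplete _ (geometric_steps_zero_cauchy hp r01 steps).
rewrite q0 in xq.
have Tq : T q = q.
  exact: (picard_limit_fixed hp hl2 hl3 hl4 hl5 hT (x := picard T x0)).
exists q; split => //.
  by rewrite /p_converges q0; under eq_fun do rewrite (pm3 hp).
move=> y yT; rewrite /p_converges q0; under eq_fun do rewrite (pm3 hp).
have [k [sk kT]] := fixed_point_contraction hp hl1 hl3 hl4 hl5 hT hstab Tq q0.
(* The triangle inequality through [T (y n)] makes [p (y n) q] contract at rate [s * k], up to the
   defect of [y] scaled by [s]. *)
apply: (cvg0_perturbed_contraction (e := fun n => s * p (y n.+1) (T (y n))) sk).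
- by move=> n; exact: p0.
- move=> n; apply: le_trans (partial_b_metric_triangle hp (T (y n)) _ _) _.
  rewrite mulrDr addrC lerD2r -mulrA ler_wpM2l//; lra.
- by rewrite -[0](mulr0 s); apply: cvgM => //; exact: cvg_cst.
Qed.
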